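(* Let $E$ be the elliptic curve $y^2=x(x-1)(x-\lambda)$ over $\mathbb{Q}$, where either (a) $\lambda=\frac{1-a^2}{a^2+2}$ with $a\in\mathbb{Q}\setminus\{0,\pm1\}$, or (b) $\lambda=\frac{a(a-2)}{a^2+1}$ with $a\in\mathbb{Q}\setminus\{0,2\}$. Then there is a squarefree polynomial $g(u)\in\mathbb{Q}[u]$ of degree $12$, which factors as a product of three quartic polynomials, such that $E_{g(u)}$ has rank at least $3$ over $\mathbb{Q}(u)$.
   Context: For $D\in\mathbb{Q}(u)^\times$, $E_D$ denotes the quadratic twist $Dy^2=x(x-1)(x-\lambda)$ over $\mathbb{Q}(u)$. *)

(* Defs.v *)
From HB Require Import structures.
From mathcomp Require Import all_boot all_order all_algebra.
From mathcomp Require Import ring.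

Set Implicit Arguments.
Unset Strict Implicit.
Unset Printing Implicit Defensive.

Import GRing.Theory.
Local Open Scope ring_scope.

Notation "x %:F" := (@FracField.tofrac _ x) : ring_scope.

(* For q = 0 the right-hand side fails, so 0 is not squarefree. *)
Definition squarefree_poly (F : fieldType) (g : {poly F}) : Prop :=
  forall q : {poly F}, q ^+ 2 %| g -> size q = 1%N.

Section LegendreTwist.

Variable K : fieldType.

(* y^2 = x(x-1)(x-lambda) is nonsingular (in characteristic not 2). *)
Definition legendre_elliptic (lambda : K) : bool :=
  (lambda != 0) && (lambda != 1).

(* None is the point at infinity, Some (x, y) an affine point. *)
Definition point := option (K * K).

(* D y^2 = x(x-1)(x-lambda) *)
Variables D lambda : K.

Definition on_twist (P : point) : bool :=
  if P is Some (x, y) then D * y ^+ 2 == x * (x - 1) * (x - lambda) else true.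

Definition twist_opp (P : point) : point :=
  if P is Some (x, y) then Some (x, - y) else None.

(* Slope of the line through two affine points of the curve that are not
   opposite to each other; for equal points it is the slope of the tangent,
   obtained by differentiating
   D y^2 = x^3 - (1 + lambda) x^2 + lambda x. *)
Definition twist_slope (x1 y1 x2 y2 : K) : K :=
  if x1 == x2
  then (3%:R * x1 ^+ 2 - 2%:R * (1 + lambda) * x1 + lambda) / (2%:R * D * y1)
  else (y2 - y1) / (x2 - x1).

(* Chord-tangent law. Substituting y = m x + c in the equation gives a cubic
   in x whose roots add up to D m^2 + 1 + lambda. *)
Definition twist_add (P Q : point) : point :=
  match P, Q with
  | None, _ => Q
  | _, None => P
  | Some (x1, y1), Some (x2, y2) =>
      if (x1 == x2) && (y1 == - y2) then None else
      let m := twist_slope x1 y1 x2 y2 in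
      let x3 := D * m ^+ 2 + 1 + lambda - x1 - x2 in
      Some (x3, m * (x1 - x3) - y1)
  end.

Definition twist_mulz (n : int) (P : point) : point :=
  match n with
  | Posz k => iter k (twist_add P) None
  | Negz k => twist_opp (iter k.+1 (twist_add P) None)
  end.

(* The rank of an abelian group is at least r when it contains r elements
   that are linearly independent over the integers. *)
Definition twist_rank_ge (r : nat) : Prop :=
  exists P : 'I_r -> point,
    (forall i, on_twist (P i)) /\
    (forall n : 'I_r -> int,
       \big[twist_add/None]_(i < r) twist_mulz (n i) (P i) = None ->
       forall i, n i = 0).

Lemma on_twist_opp (P : point) : on_twist P -> on_twist (twist_opp P).
Proof. by case: P => [[x y]|] //=; rewrite sqrrN. Qed.

Lemma twist_addN (P : point) : twist_add P (twist_opp P) = None.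
Proof. by case: P => [[x y]|] //=; rewrite opprK !eqxx. Qed.

Lemma twist_add0 (P : point) : twist_add P None = P.
Proof. by case: P => [[x y]|]. Qed.

Hypotheses (D_neq0 : D != 0) (two_neq0 : (2%:R : K) != 0).

Lemma twist_same_x (x y1 y2 : K) :
  on_twist (Some (x, y1)) -> on_twist (Some (x, y2)) ->
  y1 != - y2 -> y1 = y2.
Proof.
move=> /= /eqP e1 /eqP e2 h.
have /eqP : D * y1 ^+ 2 = D * y2 ^+ 2 by rewrite e1 e2.
rewrite (inj_eq (mulfI D_neq0)) eqf_sqr => /orP[/eqP //|h'].
by rewrite h' in h.
Qed.

Lemma twist_addC (P Q : point) : on_twist P -> on_twist Q ->
  twist_add P Q = twist_add Q P.
Proof.
case: P Q => [[x1 y1]|] [[x2 y2]|] // hP hQ.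
rewrite /twist_add /twist_slope (eq_sym x2 x1).
have -> : (y2 == - y1) = (y1 == - y2) by rewrite eq_sym eqr_oppLR.
case: eqVneq hP hQ => [<-|nx] hP hQ /=.
  by case: eqVneq => // ny; rewrite (twist_same_x hP hQ ny).
have n12 : x1 - x2 != 0 by rewrite subr_eq0.
have n21 : x2 - x1 != 0 by rewrite subr_eq0 eq_sym.
by congr (Some (_, _)); field; rewrite n12 n21.
Qed.

Lemma on_twist_add (P Q : point) : on_twist P -> on_twist Q ->
  on_twist (twist_add P Q).
Proof.
case: P Q => [[x1 y1]|] [[x2 y2]|] // hP hQ.
rewrite /twist_add /twist_slope.
case: (eqVneq x1 x2) hP hQ => [<-|nx] hP hQ /=.
  case: eqVneq => // ny; have ey := twist_same_x hP hQ ny.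
  have y0 : y1 != 0.
    apply/eqP => y0; move: ny; rewrite -ey y0 oppr0 eqxx //.
  move: hP => /= /eqP e1; set m := _ / _.
  have em : 2%:R * (D * y1 * m) =
      3%:R * x1 ^+ 2 - 2%:R * (1 + lambda) * x1 + lambda.
    by rewrite /m; field; rewrite two_neq0 D_neq0 y0.
  set x3 := D * m ^+ 2 + 1 + lambda - x1 - x1.
  have -> : D * (m * (x1 - x3) - y1) ^+ 2 =
     D * m ^+ 2 * (x1 - x3) ^+ 2 - 2%:R * (D * y1 * m) * (x1 - x3)
     + D * y1 ^+ 2 by ring.
  by rewrite em e1 /x3; apply/eqP; ring.
have n21 : x2 - x1 != 0 by rewrite subr_eq0 eq_sym.
move: hP hQ => /= /eqP e1 /eqP e2; set m := _ / _.
have em : y2 = y1 + m * (x2 - x1) by rewrite /m; field.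
set x3 := D * m ^+ 2 + 1 + lambda - x1 - x2.
have e3 : 2%:R * (D * y1 * m) =
  x1 ^+ 2 + x1 * x2 + x2 ^+ 2 - (1 + lambda) * (x1 + x2) + lambda
  - D * m ^+ 2 * (x2 - x1).
  apply: (mulfI n21).
  have -> : (x2 - x1) * (2%:R * (D * y1 * m)) =
    D * y2 ^+ 2 - D * y1 ^+ 2 - D * m ^+ 2 * (x2 - x1) ^+ 2
    by rewrite em; ring.
  by rewrite e1 e2; ring.
have -> : D * (m * (x1 - x3) - y1) ^+ 2 =
   D * m ^+ 2 * (x1 - x3) ^+ 2 - 2%:R * (D * y1 * m) * (x1 - x3)
   + D * y1 ^+ 2 by ring.
by rewrite e3 e1 /x3; apply/eqP; ring.
Qed.

End LegendreTwist.

(* Main.v *)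
Require Import Defs.
From mathcomp Require Import all_boot all_order all_algebra all_field.
From mathcomp Require Import ring lra.
Import GRing.Theory.
Local Open Scope ring_scope.

(** The invariant differential of the twist [D y^2 = f(x)] gives a map
[(x, y) |-> x' / y] into Q(u), where the prime is differentiation with respect
to [u]; it is additive, so points are independent as soon as their images are
linearly independent over Z.

For the construction, let [h] be a Moebius map permuting the roots [0, 1, lambda]
of [f].  Then [f (h x) = f x / s^6] with [s^2] an affine function of [x].  For two
suitable such maps, [(s, t)] runs over a conic, which has an obvious rational
point when [lambda] is as in (a) or (b), hence a parametrization [s = S / M],
[t = T / M] with [M], [S], [T] quadratic in [u].  The points with abscissas
[x], [h1 x], [h2 x] lie on the twist by [g = M^6 f x], a product of three
quartics, and their images in Q(u) are rational multiples of [S T], [M T] and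
[M S]. *)

(** * Additivity of the invariant differential over a field with a derivation *)

Section InvariantDifferential.

Variables (K : fieldType) (d : K -> K) (D lambda : K).
Hypotheses (dD : {morph d : x y / x + y})
  (dM : forall x y, d (x * y) = d x * y + x * d y) (dlambda : d lambda = 0).
Hypotheses (D0 : D != 0) (two0 : (2%:R : K) != 0).
Hypothesis hE : legendre_elliptic lambda.

Local Notation f' x := (3%:R * x ^+ 2 - 2%:R * (1 + lambda) * x + lambda).

(* The second equation, which follows from the first when [y != 0], still
   determines [z] at the points with [y = 0]. *)
Definition differential_at (P : point K) (z : K) : Prop :=
  if P is Some (x, y)
  then d x = z * y /\ 2%:R * D * d y + d D * y = f' x * z
  else z = 0.

Let d0 : d 0 = 0.
Proof. by apply: (addrI (d 0)); rewrite -dD !addr0. Qed.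

Let dN x : d (- x) = - d x.
Proof. by apply: (addrI (d x)); rewrite -dD !subrr. Qed.

Let d1 : d 1 = 0.
Proof. by apply: (addrI (d 1)); rewrite addr0 -{3}[1]mulr1 dM mul1r mulr1. Qed.

Let dX2 x : d (x ^+ 2) = 2%:R * x * d x.
Proof. by rewrite expr2 dM; ring. Qed.

Let dnat n : d n%:R = 0.
Proof. by elim: n => [|n IH]; rewrite ?d0 // -natr1 dD IH d1 addr0. Qed.

Let dE := (dnat, dX2, dD, dN, dM, d0, d1, dlambda).

Lemma differential_at_affine x y z :
  on_twist D lambda (Some (x, y)) -> y != 0 -> d x = z * y ->
  differential_at (Some (x, y)) z.
Proof.
move=> /= /eqP e y0 dx; split=> //; apply: (mulIf y0).
have := congr1 d e; rewrite !dE dx => e'.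
have -> : (2%:R * D * d y + d D * y) * y
  = d D * y ^+ 2 + D * (2%:R * y * d y) by ring.
by rewrite e'; ring.
Qed.

Lemma twist_nonsingular x y : on_twist D lambda (Some (x, y)) ->
  y = 0 -> f' x = 0 -> False.
Proof.
move=> /= /eqP e y0 fx; case/andP: hE => l0 l1.
have /eqP : x * (x - 1) * (x - lambda) = 0 by rewrite -e y0 expr0n mulr0.
rewrite !mulf_eq0 !subr_eq0 => /orP[/orP[]|] /eqP xE; move: fx; rewrite xE.
- by rewrite expr0n /= !mulr0 subr0 add0r => /eqP; rewrite (negPf l0).
- have -> : f' 1 = 1 - lambda by ring.
  by move/eqP; rewrite subr_eq0 eq_sym (negPf l1).
have -> : f' lambda = lambda * (lambda - 1) by ring.
by move/eqP; rewrite mulf_eq0 subr_eq0 (negPf l0) (negPf l1).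
Qed.

Lemma differential_at_uniq P z1 z2 : on_twist D lambda P ->
  differential_at P z1 -> differential_at P z2 -> z1 = z2.
Proof.
case: P => [[x y]|] hP /=; last by move=> -> ->.
move=> [a1 b1] [a2 b2]; case: (eqVneq y 0) => [y0|y0]; last first.
  by apply: (mulIf y0); rewrite -a1 -a2.
have [f0|f0] := eqVneq (f' x) 0; first by case: (twist_nonsingular _ _ hP y0).
by apply: (mulfI f0); rewrite -b1 -b2.
Qed.

Lemma differential_at_opp P z :
  differential_at P z -> differential_at (twist_opp P) (- z).
Proof.
case: P => [[x y]|] /=; last by move=> ->; rewrite oppr0.
move=> [a b]; split; first by rewrite a; ring.
by rewrite dN (mulrN (f' x)) -b; ring.
Qed.

(* [y = m x + c] meets the curve in the abscissas [x1], [x2], [x3]; the third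
   hypothesis says that [D (m x + c)^2 - f(x)] has at [x1] the derivative of
   [- (x - x1) (x - x2) (x - x3)].  In the fourth one, [2 D m' + D' m] is the
   slope of the linear form [2 D (m' x + c') + D' (m x + c)], whose value at [x1]
   is [z1 (x1 - x2) (x1 - x3)], and symmetrically at [x2]. *)
Lemma differential_at_third x1 x2 x3 y1 y2 m z1 z2 :
  x3 = D * m ^+ 2 + 1 + lambda - x1 - x2 ->
  y2 = y1 + m * (x2 - x1) ->
  2%:R * D * m * y1 = f' x1 - (x1 - x2) * (x1 - x3) ->
  2%:R * D * d m + d D * m = z1 * (x1 - x3) + z2 * (x2 - x3) ->
  differential_at (Some (x1, y1)) z1 -> differential_at (Some (x2, y2)) z2 ->
  differential_at (Some (x3, m * (x1 - x3) - y1)) (z1 + z2).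
Proof.
move=> ex3 hy hF hl /= [hx1 hy1] [hx2 _].
have hx3 : d x3 = (z1 + z2) * (m * (x1 - x3) - y1).
  rewrite ex3 !dE -ex3 hx1 hx2.
  have -> : d D * m ^+ 2 + D * (2%:R * m * d m) + 0 + 0 - z1 * y1 - z2 * y2
    = m * (2%:R * D * d m + d D * m) - z1 * y1 - z2 * y2 by ring.
  by rewrite hl hy; ring.
split=> //; rewrite !dE hx1 hx3.
set y3 := m * (x1 - x3) - y1.
(* The third hypothesis carried over to [x3], where the line has ordinate [- y3]. *)
have hF3 : 2%:R * D * m * y3 = (x3 - x1) * (x3 - x2) - f' x3.
  have -> : 2%:R * D * m * y3
    = 2%:R * (D * m ^+ 2) * (x1 - x3) - 2%:R * D * m * y1 by rewrite /y3; ring.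
  rewrite hF; have -> : D * m ^+ 2 = x1 + x2 + x3 - 1 - lambda.
    by rewrite ex3; ring.
  by ring.
have -> : 2%:R * D * (d m * (x1 - x3) + m * (z1 * y1 - (z1 + z2) * y3) - d y1)
     + d D * y3
  = (2%:R * D * d m + d D * m) * (x1 - x3) + z1 * (2%:R * D * m * y1)
    - (z1 + z2) * (2%:R * D * m * y3) - (2%:R * D * d y1 + d D * y1).
  by rewrite {2}/y3; ring.
by rewrite hl hF hF3 hy1; ring.
Qed.

(** Uniqueness gives [z2 = - z1] at opposite points and [z1 = z2] when doubling. Tangent and chord
    then reduce to [differential_at_third]. *)
Lemma differential_at_add P Q z1 z2 :
  on_twist D lambda P -> on_twist D lambda Q ->
  differential_at P z1 -> differential_at Q z2 ->
  differential_at (twist_add D lambda P Q) (z1 + z2).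
Proof.
case: P Q => [[x1 y1]|] [[x2 y2]|] hP hQ hz1 hz2; try by
  rewrite ?(hz1 : z1 = 0) ?(hz2 : z2 = 0) ?addr0 ?add0r.
rewrite /twist_add; case: ifPn => [/andP[/eqP ex /eqP ey]|hne].
  move: hz2; have -> : Some (x2, y2) = twist_opp (Some (x1, y1)).
    by rewrite ex ey /= opprK.
  move=> hz2; have := differential_at_uniq _ _ _ _ hz2 (differential_at_opp _ _ hz1).
  by rewrite on_twist_opp // => -> //=; rewrite subrr.
rewrite /twist_slope.
case: (eqVneq x1 x2) hne hP hQ hz1 hz2 => [<-|nx] /= hne hP hQ hz1 hz2.
  have ey : y2 = y1 by rewrite (twist_same_x D0 hP hQ).
  have y0 : y1 != 0.
    by apply: contra hne => /eqP y0; rewrite ey y0 oppr0.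
  rewrite ey in hQ hz2; rewrite -(differential_at_uniq (Some (x1, y1)) z1 z2 hP hz1 hz2).
  move: (hz1) => [hx hy]; set m := _ / _.
  have em : 2%:R * D * m * y1 = f' x1.
    by rewrite /m; field; rewrite two0 D0 y0.
  apply: (differential_at_third x1 x1 _ y1 y1);
    rewrite ?subrr ?mulr0 ?mul0r ?addr0 ?subr0 //.
  (* Times [y1], the remaining hypothesis follows from the derivative of the tangent equation
     [em]. *)
  clearbody m; apply: (mulIf y0) => /=.
  have := congr1 d em; rewrite !dE hx => em'.
  have -> : (2%:R * D * d m + d D * m) * y1 = (0 * D + 2%:R * d D) * m * y1
     + 2%:R * D * d m * y1 + m * (2%:R * D * d y1)
     - m * (2%:R * D * d y1 + d D * y1) by ring.
  rewrite hy.
  have -> : (0 * D + 2 * d D) * m * y1 + 2%:R * D * d m * y1 + m * (2 * D * d y1) =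
    ((0 * D + 2 * d D) * m + 2 * D * d m) * y1 + 2 * D * m * d y1 by ring.
  by rewrite em' -em; ring.
have n21 : x2 - x1 != 0 by rewrite subr_eq0 eq_sym.
set m := _ / _.
have em : y2 = y1 + m * (x2 - x1) by rewrite /m; field.
move: hP hQ (hz1) (hz2) => /eqP e1 /eqP e2 [hx1 hy1] [hx2 hy2].
clearbody m; set x3 := _ - x2.
have ex3 : x3 = D * m ^+ 2 + 1 + lambda - x1 - x2 by [].
clearbody x3.
have hF : 2%:R * D * m * y1 = f' x1 - (x1 - x2) * (x1 - x3).
  apply: (mulfI n21).
  have -> : (x2 - x1) * (2%:R * D * m * y1) =
    D * y2 ^+ 2 - D * y1 ^+ 2 - (D * m ^+ 2) * (x2 - x1) ^+ 2 by rewrite em; ring.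
  by rewrite e1 e2 ex3; ring.
apply: (differential_at_third x1 x2 _ y1 y2) => //.
(* Times [x2 - x1], it follows from the derivative of the chord equation [em]. *)
apply: (mulfI n21).
have em' := congr1 d em; rewrite !dE hx1 hx2 in em'.
have -> : (x2 - x1) * (2%:R * D * d m + d D * m) =
   2%:R * D * (d y1 + (d m * (x2 - x1) + m * (z2 * y2 - z1 * y1)))
   + d D * (y1 + m * (x2 - x1))
   - (2%:R * D * d y1 + d D * y1)
   - z2 * (2%:R * D * m * y2) + z1 * (2%:R * D * m * y1) by ring.
rewrite -em' -em hy1 hy2 {1}em.
have -> : 2 * D * m * (y1 + m * (x2 - x1))
  = 2 * D * m * y1 + 2 * (D * m ^+ 2) * (x2 - x1) by ring.
have -> : D * m ^+ 2 = x1 + x2 + x3 - 1 - lambda by rewrite ex3; ring.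
by rewrite hF; ring.
Qed.

Lemma differential_at_mulz n P z : on_twist D lambda P ->
  differential_at P z -> differential_at (twist_mulz D lambda n P) (z *~ n).
Proof.
move=> hP hz.
have h k : on_twist D lambda (iter k (twist_add D lambda P) None) /\
    differential_at (iter k (twist_add D lambda P) None) (z *+ k).
  elim: k => [|k [IH1 IH2]] //=.
  by split; [exact: on_twist_add | rewrite mulrS; exact: differential_at_add].
case: n => k; first exact: (h k).2.
by rewrite NegzE mulrNz; apply: differential_at_opp; exact: (h k.+1).2.
Qed.

Lemma on_twist_mulz n P : on_twist D lambda P ->
  on_twist D lambda (twist_mulz D lambda n P).
Proof.
move=> hP.
have h k : on_twist D lambda (iter k (twist_add D lambda P) None).
  by elim: k => // k IH; exact: on_twist_add.
by case: n => k; [exact: h | apply: on_twist_opp; exact: h].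
Qed.

(** By additivity a relation among the points passes to the [z i], since the only value at infinity
    is 0. *)
Lemma rank_ge_of_differentials r (P : 'I_r -> point K) (z : 'I_r -> K) :
  (forall i, on_twist D lambda (P i)) ->
  (forall i, differential_at (P i) (z i)) ->
  (forall n : 'I_r -> int, \sum_i z i *~ n i = 0 -> forall i, n i = 0) ->
  twist_rank_ge D lambda r.
Proof.
move=> hP hz hfree; exists P; split=> // n hn; apply: hfree.
pose R (Q : point K) w := on_twist D lambda Q /\ differential_at Q w.
have : R (\big[twist_add D lambda/None]_(i < r) twist_mulz D lambda (n i) (P i))
         (\sum_i z i *~ n i).
  apply: (big_ind2 R) => //.
    move=> Q1 w1 Q2 w2 [h1 h1'] [h2 h2'].
    by split; [exact: on_twist_add | exact: differential_at_add].
  by move=> i _; split; [exact: on_twist_mulz | exact: differential_at_mulz].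
by rewrite hn => -[].
Qed.

End InvariantDifferential.

(** * The derivation of F(u) *)

Section FractionDerivation.

Lemma quotient_ruleD (K : fieldType) (p q r s p' q' r' s' : K) :
  q != 0 -> s != 0 ->
  ((p' * s + p * s' + (r' * q + r * q')) * (q * s)
    - (p * s + r * q) * (q' * s + q * s')) / (q * s) ^+ 2
  = (p' * q - p * q') / q ^+ 2 + (r' * s - r * s') / s ^+ 2.
Proof. by move=> q0 s0; field; rewrite q0 s0. Qed.

Lemma quotient_ruleM (K : fieldType) (p q r s p' q' r' s' : K) :
  q != 0 -> s != 0 ->
  ((p' * r + p * r') * (q * s) - p * r * (q' * s + q * s')) / (q * s) ^+ 2
  = (p' * q - p * q') / q ^+ 2 * (r / s)
    + p / q * ((r' * s - r * s') / s ^+ 2).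
Proof. by move=> q0 s0; field; rewrite q0 s0. Qed.

Lemma fraction_reprE (R : idomainType) (x : {fraction R}) :
  x * (frac (repr x)).2%:F = (frac (repr x)).1%:F.
Proof.
rewrite -{1}[x]reprK; unlock FracField.tofrac.
rewrite -[LHS]FracField.pi_mul; apply/eqmodP => /=.
rewrite FracField.equivfE /FracField.mulf.
by rewrite !numden_Ratio ?mulf_neq0 ?oner_neq0 ?denom_ratioP // !mulr1 mulrC.
Qed.

Variable F : fieldType.
Implicit Types (p q : {poly F}) (x y : {fraction {poly F}}).

(** The quotient rule on the representative chosen by [repr]; [frac_deriv_div] shows independence of
    that choice. *)
Definition frac_deriv x : {fraction {poly F}} :=
  let p := (frac (repr x)).1 in let q := (frac (repr x)).2 in
  (p^`() * q - p * q^`())%:F / q%:F ^+ 2.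

Lemma frac_deriv_div p q : q != 0 ->
  frac_deriv (p%:F / q%:F) = (p^`() * q - p * q^`())%:F / q%:F ^+ 2.
Proof.
move=> q0; rewrite /frac_deriv; set x : {fraction {poly F}} := p%:F / q%:F.
have := fraction_reprE _ x; have := denom_ratioP (repr x).
case: (frac _) => n m /= m0 hx.
have qF0 : q%:F != 0 by rewrite tofrac_eq0.
have mF0 : m%:F != 0 by rewrite tofrac_eq0.
have e : p * m = n * q.
  apply/eqP; rewrite -tofrac_eq !tofracM -hx.
  by rewrite (mulrAC x) (divfK qF0).
(* The derivative of [p m = n q] makes the two quotient rules agree. *)
have e' : p^`() * m + p * m^`() = n^`() * q + n * q^`() by rewrite -!derivM e.
apply/eqP; rewrite (eqr_div _ _ (expf_neq0 2 mF0) (expf_neq0 2 qF0)).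
rewrite -2!tofracXn -2!tofracM tofrac_eq; apply/eqP.
have -> : (n^`() * m - n * m^`()) * q ^+ 2
  = (n^`() * q + n * q^`()) * (m * q) - n * q * (m * q^`() + m^`() * q) by ring.
by rewrite -e' -e; ring.
Qed.

Lemma fractionP x : exists p q, q != 0 /\ x = p%:F / q%:F.
Proof.
have h := fraction_reprE _ x; have q0 := denom_ratioP (repr x).
exists (frac (repr x)).1, (frac (repr x)).2; split=> //.
by rewrite -h mulfK // tofrac_eq0.
Qed.

Lemma frac_derivD : {morph frac_deriv : x y / x + y}.
Proof.
move=> x y; have [p [q [q0 ->]]] := fractionP x.
have [r [s [s0 ->]]] := fractionP y.
have qF0 : q%:F != 0 by rewrite tofrac_eq0.
have sF0 : s%:F != 0 by rewrite tofrac_eq0.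
have -> : p%:F / q%:F + r%:F / s%:F = (p * s + r * q)%:F / (q * s)%:F.
  by rewrite (addf_div _ _ qF0 sF0) tofracD !tofracM.
rewrite (frac_deriv_div _ _ q0) (frac_deriv_div _ _ s0).
rewrite (frac_deriv_div _ _ (mulf_neq0 q0 s0)).
rewrite derivD !derivM !(tofracB, tofracD, tofracM).
exact: (quotient_ruleD _ _ _ _ _ _ _ _ _ qF0 sF0).
Qed.

Lemma frac_derivM x y :
  frac_deriv (x * y) = frac_deriv x * y + x * frac_deriv y.
Proof.
have [p [q [q0 ->]]] := fractionP x.
have [r [s [s0 ->]]] := fractionP y.
have qF0 : q%:F != 0 by rewrite tofrac_eq0.
have sF0 : s%:F != 0 by rewrite tofrac_eq0.
have -> : p%:F / q%:F * (r%:F / s%:F) = (p * r)%:F / (q * s)%:F.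
  by rewrite !tofracM mulf_div.
rewrite (frac_deriv_div _ _ q0) (frac_deriv_div _ _ s0).
rewrite (frac_deriv_div _ _ (mulf_neq0 q0 s0)).
rewrite !derivM !(tofracB, tofracD, tofracM).
exact: (quotient_ruleM _ _ _ _ _ _ _ _ _ qF0 sF0).
Qed.

Lemma frac_derivC (c : F) : frac_deriv (c%:P)%:F = 0.
Proof.
rewrite -[_%:F]divr1 -tofrac1 frac_deriv_div ?oner_neq0 //.
by rewrite derivC mul0r -polyC1 derivC mulr0 subr0 tofrac0 mul0r.
Qed.

End FractionDerivation.

(** * Points with abscissa [N / Q^2] *)

Section QuotientPoints.

Lemma twist_quotient (K : fieldType) (n q l : K) : q != 0 ->
  n * (n - q ^+ 2) * (n - l * q ^+ 2) * (q ^- 3) ^+ 2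
  = n / q ^+ 2 * (n / q ^+ 2 - 1) * (n / q ^+ 2 - l).
Proof. by move=> q0; field. Qed.

Lemma quotient_rule_square (K : fieldType) (n q n' q' : K) : q != 0 ->
  (n' * q ^+ 2 - n * (q' * q + q * q')) / (q ^+ 2) ^+ 2
  = (n' * q - 2%:R * n * q') * q ^- 3.
Proof. by move=> q0; field. Qed.

Variables (F : fieldType) (lambda : F) (g N Q : {poly F}).
Hypotheses (Q0 : Q != 0)
  (gE : g = N * (N - Q ^+ 2) * (N - lambda%:P * Q ^+ 2)).

Definition quotient_point : point {fraction {poly F}} :=
  Some (N%:F / Q%:F ^+ 2, Q%:F ^- 3).

Let QF0 : Q%:F != 0. Proof. by rewrite tofrac_eq0. Qed.

Lemma on_twist_quotient : on_twist g%:F (lambda%:P)%:F quotient_point.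
Proof.
apply/eqP; rewrite gE !(tofracB, tofracM, tofracXn).
exact: (twist_quotient _ _ _ _ QF0).
Qed.

(** Here [x' = (N' Q - 2 N Q') / Q^3] and [y = Q^-3], so [x' / y] is a polynomial. *)
Lemma differential_at_quotient :
  differential_at _ (@frac_deriv F) g%:F (lambda%:P)%:F quotient_point
    (N^`() * Q - 2%:R * N * Q^`())%:F.
Proof.
apply: differential_at_affine.
- exact: frac_derivD.
- exact: frac_derivM.
- exact: frac_derivC.
- exact: on_twist_quotient.
- by rewrite invr_eq0 expf_neq0.
rewrite -tofracXn frac_deriv_div ?expf_neq0 //.
rewrite expr2 derivM -expr2 !(tofracB, tofracD, tofracM, tofracXn).
by rewrite (quotient_rule_square _ _ _ _ _ QF0); congr ((_ - _ * _ * _) * _).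
Qed.

End QuotientPoints.

(** * Polynomial identities by evaluation, and coprimality *)

Ltac horner_eval :=
  rewrite !(hornerD, hornerN, hornerM, horner_exp, hornerC, hornerX).

Section PolynomialIdentities.

Variable F : numFieldType.
Implicit Types p q : {poly F}.

(** In characteristic 0 a nonzero difference would have too many roots 0, 1, 2, ... This turns
    polynomial identities into ring identities between values. *)
Lemma poly_horner_inj p q : (forall x, p.[x] = q.[x]) -> p = q.
Proof.
move=> h; apply/eqP; rewrite -subr_eq0; apply/negPn/negP => pq0.
pose s : seq F := [seq i%:R | i <- iota 0 (size (p - q))].
have : (size s < size (p - q)%R)%N.
  apply: max_poly_roots => //.
    by apply/allP => x _; rewrite rootE hornerD hornerN h subrr.
  rewrite map_inj_uniq ?iota_uniq // => i j /eqP.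
  by rewrite Num.Theory.eqr_nat => /eqP.
by rewrite size_map size_iota ltnn.
Qed.

Lemma poly_quartic p k0 k1 k2 k3 k4 :
  (forall x, p.[x] = k0 + k1 * x + k2 * x ^+ 2 + k3 * x ^+ 3 + k4 * x ^+ 4) ->
  p = Poly [:: k0; k1; k2; k3; k4].
Proof.
move=> h; apply: poly_horner_inj => x; rewrite h horner_Poly /=; ring.
Qed.

Lemma coprimep_bezout (u v p q : {poly F}) (k : F) :
  k != 0 -> u * p + v * q = k%:P -> coprimep p q.
Proof.
move=> k0 e; apply/Bezout_coprimepP; exists (u, v); rewrite /= e.
by rewrite polyC_eqp1.
Qed.

(** Modulo [p] the combination is [b q^2]. *)
Lemma coprimep_sqr_comb p q (a b : F) : b != 0 -> coprimep p q ->
  coprimep p (a%:P * p ^+ 2 + b%:P * q ^+ 2).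
Proof.
move=> b0 pq; rewrite expr2 mulrA coprimep_addl_mul mul_polyC coprimepZr //.
exact: coprimep_expr.
Qed.

End PolynomialIdentities.

(** * The parametrized conic and the quartic factors *)

Section ConicParametrization.

Variables (F : numFieldType) (b d s0 t0 : F).
Hypotheses (b0 : b != 0) (d0 : d != 0) (s00 : s0 != 0) (t00 : t0 != 0).
Hypothesis nondeg : b * s0 ^+ 2 - d * t0 ^+ 2 != 0.

(* The conic [b s^2 - d t^2 = b s0^2 - d t0^2] is parametrized by
   [(s, t) = (S / M, T / M)], where [u] is the slope of the line through
   [(s0, t0)]. *)
Definition conicM : {poly F} := b%:P - d%:P * 'X^2.
Definition conicS : {poly F} :=
  (- b * s0)%:P + (2%:R * d * t0)%:P * 'X - (d * s0)%:P * 'X^2.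
Definition conicT : {poly F} :=
  (b * t0)%:P - (2%:R * b * s0)%:P * 'X + (d * t0)%:P * 'X^2.

Local Notation M := conicM.
Local Notation S := conicS.
Local Notation T := conicT.

Lemma horner_conic x :
  (M.[x] = b - d * x ^+ 2) *
  (S.[x] = - b * s0 + 2%:R * d * t0 * x - d * s0 * x ^+ 2) *
  (T.[x] = b * t0 - 2%:R * b * s0 * x + d * t0 * x ^+ 2).
Proof. by rewrite /conicM /conicS /conicT; horner_eval. Qed.

Lemma conic_neq0 : [/\ M != 0, S != 0 & T != 0].
Proof.
have nz (p : {poly F}) : p.[0] != 0 -> p != 0.
  by apply: contra => /eqP ->; rewrite horner0.
by split; apply: nz; rewrite !horner_conic expr0n /= !(mulr0, addr0, subr0)
  ?mulf_neq0 ?oppr_eq0.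
Qed.

Lemma horner_deriv_conic x :
  (M^`().[x] = - (2%:R * d * x)) *
  (S^`().[x] = 2%:R * d * t0 - 2%:R * d * s0 * x) *
  (T^`().[x] = - (2%:R * b * s0) + 2%:R * d * t0 * x).
Proof.
rewrite /conicM /conicS /conicT !derivE; horner_eval.
by split; [split|]; ring.
Qed.

Lemma conicE : b%:P * S ^+ 2 - d%:P * T ^+ 2
  = (b * s0 ^+ 2 - d * t0 ^+ 2)%:P * M ^+ 2.
Proof. by apply: poly_horner_inj => x; horner_eval; rewrite ?horner_conic; ring. Qed.

(** Divided by [M^2] this is [s' = 2 d t / M]; with [t' = 2 b s / M] below, it reflects
    [b s s' = d t t'] on the conic. *)
Lemma wronskian_conicSM : S^`() * M - S * M^`() = (2%:R * d)%:P * T.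
Proof.
apply: poly_horner_inj => x; horner_eval.
by rewrite ?horner_conic ?horner_deriv_conic; ring.
Qed.

Lemma wronskian_conicTM : T^`() * M - T * M^`() = (2%:R * b)%:P * S.
Proof.
apply: poly_horner_inj => x; horner_eval.
by rewrite ?horner_conic ?horner_deriv_conic; ring.
Qed.

Lemma coprime_conicMS : coprimep M S.
Proof.
(* [S - s0 M] is the linear polynomial [2 (d t0 X - b s0)]; multiplying by its conjugate [v] leaves
   only an [X^2] term, which [2 d t0^2 M] cancels, and a constant. *)
pose v : {poly F} := (d * t0)%:P * 'X + (b * s0)%:P.
apply: (@coprimep_bezout _ ((2%:R * d * t0 ^+ 2)%:P - s0%:P * v) v _ _
  (- (2%:R * b * (b * s0 ^+ 2 - d * t0 ^+ 2)))).
  by rewrite oppr_eq0 !mulf_neq0 // Num.Theory.pnatr_eq0.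
by apply: poly_horner_inj => x; horner_eval; rewrite ?horner_conic; ring.
Qed.

(** Modulo [M] the conic equation reads [b S^2 = d T^2]. *)
Lemma coprime_conicMT : coprimep M T.
Proof.
have := coprimep_sqr_comb _ _ _ (- (b * s0 ^+ 2 - d * t0 ^+ 2)) b b0 coprime_conicMS.
have -> : (- (b * s0 ^+ 2 - d * t0 ^+ 2))%:P * M ^+ 2 + b%:P * S ^+ 2
   = d%:P * T ^+ 2.
  by rewrite polyCN mulNr -conicE; ring.
by rewrite mul_polyC coprimepZr // coprimep_pexpr.
Qed.

Variable a : F.
Local Notation a' := (a + b * s0 ^+ 2 - d * t0 ^+ 2).

(* [fiber c / M^2] is [x - c], where [x = a + b s^2 = a' + d t^2]. *)
Definition fiber (c : F) : {poly F} := (a - c)%:P * M ^+ 2 + b%:P * S ^+ 2.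

Lemma fiberTE c : fiber c = (a' - c)%:P * M ^+ 2 + d%:P * T ^+ 2.
Proof.
by apply: poly_horner_inj => x; horner_eval; rewrite ?horner_conic; ring.
Qed.

(** At [u = infinity] the conic point is [(s0, - t0)], where [x = a + b s0^2]; hence the leading
    coefficient [d^2 (a + b s0^2 - c)]. *)
Lemma size_fiber c : a + b * s0 ^+ 2 != c -> size (fiber c) = 5%N.
Proof.
move=> hc; rewrite (poly_quartic _ (fiber c)
  ((a - c) * b ^+ 2 + b * b ^+ 2 * s0 ^+ 2)
  (- 2%:R * b * (b * s0) * (2%:R * d * t0))
  (- 2%:R * (a - c) * b * d
    + b * ((2%:R * d * t0) ^+ 2 + 2%:R * (b * s0) * (d * s0)))
  (- 2%:R * b * (2%:R * d * t0) * (d * s0))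
  (d ^+ 2 * (a + b * s0 ^+ 2 - c))).
  by rewrite (@PolyK _ 0) //= mulf_neq0 ?expf_neq0 // subr_eq0.
by move=> x; horner_eval; rewrite ?horner_conic; ring.
Qed.

(** Divided by [M^3], this is [x' = 2 b s s']. *)
Lemma wronskian_fiber c :
  (fiber c)^`() * M - 2%:R * fiber c * M^`() = (4%:R * b * d)%:P * (S * T).
Proof.
have -> : (4%:R * b * d)%:P * (S * T) = (2%:R * b)%:P * S * ((2%:R * d)%:P * T).
  by apply: poly_horner_inj => x; horner_eval; ring.
rewrite -wronskian_conicSM /fiber !derivE.
apply: poly_horner_inj => x; horner_eval.
by rewrite ?horner_conic ?horner_deriv_conic; ring.
Qed.

(** By the Wronskian a multiple root would be a root of [S T]; [a != c] excludes the roots of [S],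
    and [a' != c] those of [T]. *)
Lemma separable_fiber c : a != c -> a' != c -> separable_poly (fiber c).
Proof.
move=> hc hc'; rewrite unlock.
have cM : coprimep (fiber c) M.
  by rewrite coprimep_sym coprimep_sqr_comb // coprime_conicMS.
suff : coprimep (fiber c) ((fiber c)^`() * M) by rewrite coprimepMr => /andP[].
have -> : (fiber c)^`() * M
  = (2%:R * M^`()) * fiber c + (4%:R * b * d)%:P * (S * T).
  by rewrite -(wronskian_fiber c); ring.
rewrite coprimep_addl_mul mul_polyC coprimepZr; last first.
  by rewrite !mulf_neq0 // Num.Theory.pnatr_eq0.
rewrite coprimepMr; apply/andP; split; rewrite coprimep_sym.
  by rewrite /fiber addrC coprimep_sqr_comb ?subr_eq0 // coprimep_sym coprime_conicMS.
rewrite fiberTE addrC coprimep_sqr_comb ?subr_eq0 //.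
by rewrite coprimep_sym coprime_conicMT.
Qed.

(** The fibers differ by a nonzero constant times [M^2], and [M] is prime to [fiber c]. *)
Lemma coprime_fiber c c' : c != c' -> coprimep (fiber c) (fiber c').
Proof.
move=> hc; have -> : fiber c' = 1 * fiber c + (c - c')%:P * M ^+ 2.
  by apply: poly_horner_inj => x; horner_eval; ring.
rewrite coprimep_addl_mul mul_polyC coprimepZr ?subr_eq0 //.
by apply: coprimep_expr; rewrite coprimep_sym coprimep_sqr_comb // coprime_conicMS.
Qed.

(** The coefficient of [X^2] isolates [k1]. Those of degrees 0 and 1 then give a linear system in
    [k2], [k3] whose determinant is [b s0^2 - d t0^2] up to a nonzero factor. *)
Lemma conic_products_free (k1 k2 k3 : F) :
  k1%:P * (S * T) + k2%:P * (M * T) + k3%:P * (M * S) = 0 ->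
  [/\ k1 = 0, k2 = 0 & k3 = 0].
Proof.
pose p := k1%:P * (S * T) + k2%:P * (M * T) + k3%:P * (M * S).
move=> p0.
have/(_ _)/Wrap[x|pE] := poly_quartic _ p
  (b ^+ 2 * (k2 * t0 - k3 * s0 - k1 * (s0 * t0)))
  (2%:R * b * (k1 * (b * s0 ^+ 2 + d * t0 ^+ 2) - k2 * (b * s0) + k3 * (d * t0)))
  (- k1 * (6%:R * b * d * s0 * t0))
  (2%:R * d * (k1 * (b * s0 ^+ 2 + d * t0 ^+ 2) + k2 * (b * s0) - k3 * (d * t0)))
  (d ^+ 2 * (- (k2 * t0 - k3 * s0) - k1 * (s0 * t0))).
  by horner_eval; rewrite ?horner_conic; ring.
have c i := congr1 (fun q : {poly F} => q`_i) pE.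
have := c 1%N; have := c 2%N; have := c 0%N.
rewrite !coef_Poly /= /p p0 !coef0.
move=> /esym/eqP; rewrite mulf_eq0 expf_eq0 /= (negPf b0) /= => /eqP h0.
move=> /esym/eqP; rewrite mulNr oppr_eq0 !mulf_eq0 (negPf b0) (negPf d0).
rewrite (negPf s00) (negPf t00) Num.Theory.pnatr_eq0 /= !orbF => /eqP k10.
move: h0; rewrite k10 mul0r subr0 => h0.
move=> /esym/eqP; rewrite !mulf_eq0 Num.Theory.pnatr_eq0 (negPf b0) /=.
rewrite mul0r add0r => /eqP h1.
have k30 : k3 = 0.
  apply: (mulfI nondeg); rewrite mulr0.
  have -> : (b * s0 ^+ 2 - d * t0 ^+ 2) * k3 = - (b * s0) * (k2 * t0 - k3 * s0)
     + t0 * (k2 * (b * s0) - k3 * (d * t0)) by ring.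
  have -> : k2 * (b * s0) - k3 * (d * t0) = - (- (k2 * (b * s0)) + k3 * (d * t0)) by ring.
  by rewrite h0 h1 oppr0 !mulr0 addr0.
split=> //; apply: (mulIf t00); rewrite mul0r -[RHS]h0 k30; ring.
Qed.

End ConicParametrization.

(** * Rank three from a conic with a rational point *)

Definition quartic_product_twist_rank3 {F : numFieldType} (lambda : F) : Prop :=
  exists g : {poly F},
    [/\ squarefree_poly g,
        size g = 13%N,
        exists q1 q2 q3 : {poly F},
          [/\ size q1 = 5%N, size q2 = 5%N, size q3 = 5%N
            & g = q1 * q2 * q3]
      & @twist_rank_ge {fraction {poly F}} g%:F (lambda%:P)%:F 3].

(* [x = a + b s^2 = a' + d t^2], with [x0] its value at [(s0, t0)].  With
   [A = M^2] and [B = S^2] (resp. [B = T^2]), [N / B] is the Moebius image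
   [h x] and the cubic identity is [f (h x) = f x / s^6] (resp. [f x / t^6]). *)
Lemma twist_rank3_of_conic (F : numFieldType)
    (lambda a a' b d s0 t0 x0 p q r v : F) :
  x0 = a + b * s0 ^+ 2 -> x0 = a' + d * t0 ^+ 2 ->
  legendre_elliptic lambda ->
  b != 0 -> d != 0 -> s0 != 0 -> t0 != 0 -> a != a' ->
  [/\ a != 0, a != 1 & a != lambda] ->
  [/\ a' != 0, a' != 1 & a' != lambda] ->
  [/\ x0 != 0, x0 != 1 & x0 != lambda] ->
  (forall A B, let N := p * B + q * A in
    N * (N - B) * (N - lambda * B)
    = (a * A + b * B) * ((a - 1) * A + b * B) * ((a - lambda) * A + b * B)) ->
  (forall A B, let N := r * B + v * A in
    N * (N - B) * (N - lambda * B)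
    = (a' * A + d * B) * ((a' - 1) * A + d * B) * ((a' - lambda) * A + d * B)) ->
  quartic_product_twist_rank3 lambda.
Proof.
move=> x0E x0E' hE b0 d0 s00 t00 aa' [a0 a1 al] [a'0 a'1 a'l] [x00 x01 x0l] hS hT.
(* If this vanished, the two expressions of [x0] would give [a = a']. *)
have nondeg : b * s0 ^+ 2 - d * t0 ^+ 2 != 0.
  apply: contra aa'; rewrite subr_eq0 => /eqP e; apply/eqP.
  by apply: (addIr (d * t0 ^+ 2)); rewrite -x0E' x0E e.
have {x0E'} a'E : a' = a + b * s0 ^+ 2 - d * t0 ^+ 2 by rewrite -x0E x0E' addrK.
subst a'; subst x0.
have [l0 l1] := andP hE.
pose M := conicM _ b d; pose S := conicS _ b d s0 t0; pose T := conicT _ b d s0 t0.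
pose f := fiber _ b d s0 t0 a; pose g := f 0 * f 1 * f lambda.
have sz c : a + b * s0 ^+ 2 != c -> size (f c) = 5%N by exact: size_fiber.
have f0 c : a + b * s0 ^+ 2 != c -> f c != 0 by move=> hc; rewrite -size_poly_gt0 sz.
have szg : size g = 13%N.
  by rewrite /g !size_mul ?mulf_neq0 ?f0 // !sz.
exists g; split => //.
- have sep : separable_poly g.
    rewrite /g !separable_mul !separable_fiber //= !coprimepMl.
    by rewrite !coprime_fiber // 1?eq_sym // oner_neq0.
  move=> h hg; apply/eqP; apply: contraT => szh.
  by rewrite (separable_nosquare sep (ltnSn 1) szh) in hg.
- by exists (f 0), (f 1), (f lambda); rewrite !sz.
(* [N1 / M^2], [N2 / S^2], [N3 / T^2] are [x], [h1 x], [h2 x]; the cubic identities put all three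
   points on the twist by the same [g]. *)
pose N1 := a%:P * M ^+ 2 + b%:P * S ^+ 2.
pose N2 := p%:P * S ^+ 2 + q%:P * M ^+ 2.
pose N3 := r%:P * T ^+ 2 + v%:P * M ^+ 2.
have g1 : g = N1 * (N1 - M ^+ 2) * (N1 - lambda%:P * M ^+ 2).
  by apply: poly_horner_inj => x; rewrite /g /f /fiber /N1; horner_eval; ring.
have g2 : g = N2 * (N2 - S ^+ 2) * (N2 - lambda%:P * S ^+ 2).
  apply: poly_horner_inj => x; rewrite /g /f /fiber /N2; horner_eval.
  by rewrite hS subr0.
have g3 : g = N3 * (N3 - T ^+ 2) * (N3 - lambda%:P * T ^+ 2).
  rewrite /g /f !fiberTE /N3; apply: poly_horner_inj => x; horner_eval.
  by rewrite hT subr0.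
have [M0 S0 T0] := conic_neq0 _ b d s0 t0 b0 s00 t00.
pose w (N Q : {poly F}) : {poly F} := N^`() * Q - 2%:R * N * Q^`().
have w1 : w N1 M = (4%:R * b * d)%:P * (S * T).
  rewrite -(wronskian_fiber _ b d s0 t0 a 0) /fiber subr0 //.
(* Since [N2 / S^2 = p + q (M / S)^2], only the [q] term contributes. *)
have w2 : w N2 S = (- (4%:R * q * d))%:P * (M * T).
  have -> : (- (4%:R * q * d))%:P * (M * T)
    = - ((2%:R * q)%:P * M * ((2%:R * d)%:P * T)).
    by apply: poly_horner_inj => x; horner_eval; ring.
  rewrite -wronskian_conicSM -/M -/S /w /N2 !derivE.
  by apply: poly_horner_inj => x; horner_eval; ring.
have w3 : w N3 T = (- (4%:R * v * b))%:P * (M * S).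
  have -> : (- (4%:R * v * b))%:P * (M * S)
    = - ((2%:R * v)%:P * M * ((2%:R * b)%:P * S)).
    by apply: poly_horner_inj => x; horner_eval; ring.
  rewrite -wronskian_conicTM -/M -/T /w /N3 !derivE.
  by apply: poly_horner_inj => x; horner_eval; ring.
have nz3 c : c != 0 -> c != 1 -> c != lambda -> c * (c - 1) * (c - lambda) != 0.
  by move=> *; rewrite !mulf_neq0 // subr_eq0.
(* At [(A, B) = (1, 0)] the cubic identity reads [q^3 = a (a - 1) (a - lambda)]. *)
have q0 : q != 0.
  apply/eqP => q0; have/eqP[] := nz3 a a0 a1 al; have := hS 1 0.
  by rewrite /= q0 !(mulr0, mul0r, addr0, add0r, mulr1) => <-.
have v0 : v != 0.
  apply/eqP => v0; have/eqP[] := nz3 _ a'0 a'1 a'l; have := hT 1 0.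
  by rewrite /= v0 !(mulr0, mul0r, addr0, add0r, mulr1) => <-.
pose NQ : seq ({poly F} * {poly F}) := [:: (N1, M); (N2, S); (N3, T)].
pose P (i : 'I_3) := quotient_point F (nth (0, 0) NQ i).1 (nth (0, 0) NQ i).2.
pose z (i : 'I_3) := (w (nth (0, 0) NQ i).1 (nth (0, 0) NQ i).2)%:F.
apply: (rank_ge_of_differentials _ (@frac_deriv F) _ _ _ _ _ _ _ _ _ P z).
- exact: frac_derivD.
- exact: frac_derivM.
- exact: frac_derivC.
- by rewrite tofrac_eq0 -size_poly_gt0 szg.
- by rewrite -(rmorph_nat (@FracField.tofrac {poly F})) tofrac_eq0 -polyC_natr polyC_eq0
    Num.Theory.pnatr_eq0.
- by rewrite /legendre_elliptic -tofrac0 -tofrac1 !tofrac_eq -polyC1 !polyC_eq0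
    (inj_eq (@polyC_inj _)) l0.
- by case=> [[|[|[|//]]] ?]; exact: on_twist_quotient.
- by case=> [[|[|[|//]]] ?]; exact: differential_at_quotient.
move=> n; rewrite !big_ord_recl big_ord0 addr0 /z /= w1 w2 w3.
rewrite -!rmorphMz -!rmorphD => /eqP; rewrite tofrac_eq0 => /eqP e.
have [] := conic_products_free _ b d s0 t0 b0 d0 s00 t00 nondeg
  ((4%:R * b * d) *~ n ord0) (- (4%:R * q * d) *~ n (lift ord0 ord0))
  (- (4%:R * v * b) *~ n (lift ord0 (lift ord0 ord0))).
  by rewrite -[RHS]e !(rmorphMz (@polyC F)) !mulrzAl addrA.
move=> /eqP h1 /eqP h2 /eqP h3.
have mz (c : F) m : c != 0 -> c *~ m == 0 -> m = 0.
  by move=> c0; rewrite mulrz_eq0 (negPf c0) orbF => /eqP.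
case=> [[|[|[|//]]] i3].
- rewrite -(mz _ _ _ h1) ?mulf_neq0 ?Num.Theory.pnatr_eq0 //.
  by congr n; exact: val_inj.
- rewrite -(mz _ _ _ h2) ?oppr_eq0 ?mulf_neq0 ?Num.Theory.pnatr_eq0 //.
  by congr n; exact: val_inj.
- rewrite -(mz _ _ _ h3) ?oppr_eq0 ?mulf_neq0 ?Num.Theory.pnatr_eq0 //.
  by congr n; exact: val_inj.
Qed.

(** * The two families of [lambda] *)

(** In [num^2 = 5 den^2] the 5-adic valuation is even on the left and odd on the right. *)
Lemma rat_sqr_neq5 (x : rat) : x ^+ 2 != 5%:R.
Proof.
apply/eqP => x5; have x0 : x != 0 by apply: contra_eqN x5 => /eqP ->.
have e : numq x ^+ 2 = 5%:R * denq x ^+ 2.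
  apply: (@intr_inj rat); rewrite rmorphXn rmorphM rmorphXn rmorph_nat -x5 -exprMn.
  by rewrite -{2}[x]divq_num_den mulfVK ?intr_eq0 ?denq_eq0.
have {e} e : (`|numq x| ^ 2 = 5 * `|denq x| ^ 2)%N.
  by rewrite -!abszX e abszM.
have := congr1 (fun k => odd (logn 5 k)) e => /=.
rewrite lognM ?expn_gt0 ?absz_gt0 ?denq_eq0 // !lognX oddD !oddM //=.
Qed.

(* The Moebius maps are the involution exchanging 0 and 1 and fixing [lambda],
   and the cycle 0 -> 1 -> [lambda] -> 0; with [e = lambda (lambda - 1)],
   [e s^2 = (1 - 2 lambda) x + lambda^2] and [e t^2 = (e + 1) x - lambda^2]. *)
Lemma twist_rank3_case_a (a lambda : rat) : legendre_elliptic lambda ->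
  lambda = (1 - a ^+ 2) / (a ^+ 2 + 2%:R) -> a != 0 ->
  quartic_product_twist_rank3 lambda.
Proof.
move=> hE lE a0; have /andP[l0] := hE; rewrite -subr_eq0 => l1.
have a20 : a ^+ 2 + 2%:R != 0 by nra.
have n12 : 1 - 2%:R * lambda != 0.
  have -> : 1 - 2%:R * lambda = 3%:R * a ^+ 2 / (a ^+ 2 + 2%:R).
    by rewrite lE; field.
  by rewrite !mulf_neq0 ?invr_eq0 ?expf_neq0.
have l2 : lambda - 2%:R != 0.
  have -> : lambda - 2%:R = - 3%:R * (a ^+ 2 + 1) / (a ^+ 2 + 2%:R).
    by rewrite lE; field.
  rewrite !mulf_neq0 ?invr_eq0 //; nra.
have q0 : lambda ^+ 2 - lambda + 1 != 0 by nra.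
have l2' : 2%:R * lambda - 1 != 0 by rewrite -opprB oppr_eq0.
(* The formula for [lambda], solved for [a^2], puts [(1, a^-1)] on the conic. *)
have ea : (a^-1) ^+ 2 = (1 + lambda) / (1 - 2%:R * lambda).
  have a2E : a ^+ 2 * (1 + lambda) = 1 - 2%:R * lambda by rewrite lE; field.
  have l1' : 1 + lambda != 0.
    by move: n12; rewrite -a2E mulf_eq0 => /norP[].
  by rewrite -a2E; field; rewrite l1' a0.
have e0 : lambda * (lambda - 1) != 0 by rewrite mulf_neq0.
have neq (x y : rat) : x - y != 0 -> x != y by rewrite subr_eq0.
(* Solving the equations of [s^2] and [t^2] for [x] gives the first four values. The last four write
   the maps as [h1 x = p + q / s^2] and [h2 x = r + v / t^2]. *)
apply: (@twist_rank3_of_conic _ lambda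
  (- lambda ^+ 2 / (1 - 2%:R * lambda)) (lambda ^+ 2 / (lambda ^+ 2 - lambda + 1))
  (lambda * (lambda - 1) / (1 - 2%:R * lambda))
  (lambda * (lambda - 1) / (lambda ^+ 2 - lambda + 1))
  1 a^-1 (lambda / (2%:R * lambda - 1))
  (- lambda ^+ 2 / (1 - 2%:R * lambda))
  (lambda * (lambda - 1) / (1 - 2%:R * lambda))
  (lambda / (lambda ^+ 2 - lambda + 1))
  (- (lambda * (lambda - 1)) / (lambda ^+ 2 - lambda + 1))) => //.
- by field; rewrite l2' n12.
- by rewrite ea; field; rewrite l2' n12 q0.
- by rewrite mulf_neq0 ?invr_eq0.
- by rewrite mulf_neq0 ?invr_eq0.
- by rewrite invr_eq0.
- apply: neq; have -> : - lambda ^+ 2 / (1 - 2%:R * lambda)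
      - lambda ^+ 2 / (lambda ^+ 2 - lambda + 1)
    = - lambda ^+ 2 * (lambda - 1) * (lambda - 2%:R)
      / (1 - 2%:R * lambda) / (lambda ^+ 2 - lambda + 1).
    by field; rewrite n12 q0.
  by rewrite !mulf_neq0 ?invr_eq0 ?oppr_eq0 ?expf_neq0.
- split; first by rewrite !mulf_neq0 ?invr_eq0 ?oppr_eq0 ?expf_neq0.
    apply: neq; have -> : - lambda ^+ 2 / (1 - 2%:R * lambda) - 1
      = - (lambda - 1) ^+ 2 / (1 - 2%:R * lambda) by field.
    by rewrite !mulf_neq0 ?invr_eq0 ?oppr_eq0 ?expf_neq0.
  apply: neq; have -> : - lambda ^+ 2 / (1 - 2%:R * lambda) - lambda
    = lambda * (lambda - 1) / (1 - 2%:R * lambda) by field.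
  by rewrite !mulf_neq0 ?invr_eq0.
- split; first by rewrite !mulf_neq0 ?invr_eq0 ?expf_neq0.
    apply: neq; have -> : lambda ^+ 2 / (lambda ^+ 2 - lambda + 1) - 1
      = (lambda - 1) / (lambda ^+ 2 - lambda + 1) by field.
    by rewrite !mulf_neq0 ?invr_eq0.
  apply: neq; have -> : lambda ^+ 2 / (lambda ^+ 2 - lambda + 1) - lambda
    = - lambda * (lambda - 1) ^+ 2 / (lambda ^+ 2 - lambda + 1) by field.
  by rewrite !mulf_neq0 ?invr_eq0 ?oppr_eq0 ?expf_neq0.
- split; first by rewrite !mulf_neq0 ?invr_eq0.
    apply: neq; have -> : lambda / (2%:R * lambda - 1) - 1
      = - (lambda - 1) / (2%:R * lambda - 1) by field.
    by rewrite !mulf_neq0 ?invr_eq0 ?oppr_eq0.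
  apply: neq; have -> : lambda / (2%:R * lambda - 1) - lambda
    = - 2%:R * lambda * (lambda - 1) / (2%:R * lambda - 1) by field.
  by rewrite !mulf_neq0 ?invr_eq0 ?oppr_eq0.
- by move=> A B /=; field.
- by move=> A B /=; field.
Qed.

(* The Moebius maps are the involutions exchanging 0 and [lambda], resp. 1 and
   [lambda], and fixing the third root; [(1 - lambda) s^2 = 1 - (2 - lambda) x]
   and [lambda t^2 = (1 + lambda) x - lambda]. *)
Lemma twist_rank3_case_b (a lambda : rat) : legendre_elliptic lambda ->
  lambda = a * (a - 2%:R) / (a ^+ 2 + 1) ->
  quartic_product_twist_rank3 lambda.
Proof.
move=> hE lE; have /andP[l0] := hE; rewrite -subr_eq0 => l1.
have a21 : a ^+ 2 + 1 != 0 by nra.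
(* [a] is a root of [(1 - lambda) X^2 - 2 X - lambda], and completing the square makes [w] a square
   root of the quarter discriminant. *)
pose w := (1 - lambda) * a - 1.
have w2 : w ^+ 2 = 1 + lambda - lambda ^+ 2 by rewrite /w lE; field.
(* [1 + lambda - lambda^2] has discriminant 5, so it has no rational root. *)
have w0 : w != 0.
  apply: contra (rat_sqr_neq5 (2%:R * lambda - 1)) => /eqP w0; apply/eqP.
  have -> : (2%:R * lambda - 1) ^+ 2 = 5%:R - 4%:R * (1 + lambda - lambda ^+ 2) by ring.
  by rewrite -w2 w0; ring.
(* For [lambda] equal to -1 or 2, [w^2] would be -1. *)
have l1' : 1 + lambda != 0 by nra.
have l2 : 2%:R - lambda != 0 by nra.
have q0 : lambda ^+ 2 - lambda + 1 != 0 by nra.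
have neq (x y : rat) : x - y != 0 -> x != y by rewrite subr_eq0.
have p0 : 1 + lambda - lambda ^+ 2 != 0 by rewrite -w2 expf_neq0.
have sw : (w^-1) ^+ 2 = (1 + lambda - lambda ^+ 2)^-1 by rewrite exprVn w2.
(* The rational point [(w^-1, lambda w^-1)] has abscissa [lambda / w^2]. *)
apply: (@twist_rank3_of_conic _ lambda
  (2%:R - lambda)^-1 (lambda / (1 + lambda))
  ((lambda - 1) / (2%:R - lambda)) (lambda / (1 + lambda))
  w^-1 (lambda * w^-1) (lambda / (1 + lambda - lambda ^+ 2))
  (2%:R - lambda)^-1 ((lambda - 1) / (2%:R - lambda))
  (lambda / (1 + lambda)) (lambda / (1 + lambda))) => //.
- by rewrite sw; field; rewrite l2 p0.
- by rewrite exprMn sw; field; rewrite l1' p0.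
- by rewrite mulf_neq0 ?invr_eq0.
- by rewrite mulf_neq0 ?invr_eq0.
- by rewrite invr_eq0.
- by rewrite mulf_neq0 ?invr_eq0.
- apply: neq; have -> : (2%:R - lambda)^-1 - lambda / (1 + lambda)
    = (lambda ^+ 2 - lambda + 1) / (2%:R - lambda) / (1 + lambda).
    by field; rewrite l1' l2.
  by rewrite !mulf_neq0 ?invr_eq0.
- split; first by rewrite invr_eq0.
    apply: neq; have -> : (2%:R - lambda)^-1 - 1 = (lambda - 1) / (2%:R - lambda).
      by field.
    by rewrite !mulf_neq0 ?invr_eq0.
  apply: neq; have -> : (2%:R - lambda)^-1 - lambda
    = (lambda - 1) ^+ 2 / (2%:R - lambda) by field.
  by rewrite !mulf_neq0 ?invr_eq0 ?expf_neq0.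
- split; first by rewrite !mulf_neq0 ?invr_eq0.
    apply: neq; have -> : lambda / (1 + lambda) - 1 = - (1 + lambda)^-1 by field.
    by rewrite oppr_eq0 invr_eq0.
  apply: neq; have -> : lambda / (1 + lambda) - lambda
    = - lambda ^+ 2 / (1 + lambda) by field.
  by rewrite !mulf_neq0 ?invr_eq0 ?oppr_eq0 ?expf_neq0.
- split; first by rewrite !mulf_neq0 ?invr_eq0.
    apply: neq; have -> : lambda / (1 + lambda - lambda ^+ 2) - 1
      = (lambda - 1) * (1 + lambda) / (1 + lambda - lambda ^+ 2) by field.
    by rewrite !mulf_neq0 ?invr_eq0.
  apply: neq; have -> : lambda / (1 + lambda - lambda ^+ 2) - lambda
    = lambda ^+ 2 * (lambda - 1) / (1 + lambda - lambda ^+ 2) by field.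
  by rewrite !mulf_neq0 ?invr_eq0 ?expf_neq0.
- by move=> A B /=; field.
- by move=> A B /=; field.
Qed.

Theorem theorem4p2 (a lambda : rat)
  (hlambda :
     [/\ lambda = (1 - a ^+ 2) / (a ^+ 2 + 2), a != 0, a != 1 & a != -1] \/
     [/\ lambda = a * (a - 2) / (a ^+ 2 + 1), a != 0 & a != 2])
  (hE : legendre_elliptic lambda) :
  exists g : {poly rat},
    [/\ squarefree_poly g,
        size g = 13%N (* degree 12 *),
        exists q1 q2 q3 : {poly rat},
          [/\ size q1 = 5%N, size q2 = 5%N, size q3 = 5%N
            & g = q1 * q2 * q3]
      & @twist_rank_ge {fraction {poly rat}} g%:F (lambda%:P)%:F 3].
Proof.
case: hlambda => [[lE a0 _ _]|[lE _ _]].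
  exact: (twist_rank3_case_a a lambda hE lE a0).
exact: (twist_rank3_case_b a lambda hE lE).
Qed.
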